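(* Let $\varepsilon>0$ and let $f:\Omega\times\Omega\to\mathbb{R}$ be a continuous function, where $\Omega=[a,b]$ with $-\infty<a<b<\infty$. Let $d=d(\varepsilon)>0$ be such that $|f(x,y)-f(x,z)|\le \frac{\varepsilon\|f\|_{L^2}}{4(b-a)}$ for all $x\in\Omega$ and all $y,z\in\Omega$ with $|y-z|<d$. Let $H_m(f)$ be the continuous Hutchinson's estimate of $\mathrm{tr}(f)$ with $m\ge 1$ probe functions drawn from $\mathcal{GP}(0,K_{SE})$, where the squared exponential kernel $K_{SE}$ has length-scale parameter $\ell>0$ satisfying $$\ell<\min\left\{\frac{d}{\sqrt{2\log\left(8\|f\|_\infty(b-a)/(\varepsilon\|f\|_{L^2})\right)}},\ \frac{5\varepsilon\|f\|_{L^2}}{26\|f\|_\infty}\right\}.$$ Then $|\mathbb{E}[H_m(f)]-\mathrm{tr}(f)|<\varepsilon\|f\|_{L^2}$.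
   Context: For continuous $f:\Omega\times\Omega\to\mathbb{R}$: $\mathrm{tr}(f)=\int_\Omega f(x,x)\,dx$; $\|f\|_{L^2}$ is the norm of $L^2(\Omega\times\Omega)$; $\|f\|_\infty=\max_{x,y\in\Omega}|f(x,y)|$. For a continuous positive (semi)definite kernel $K:\Omega\times\Omega\to\mathbb{R}$, $g\sim\mathcal{GP}(0,K)$ denotes a centered Gaussian process on $\Omega$ with covariance $\mathbb{E}[g(x)g(y)]=K(x,y)$, i.e. for all $x_1,\dots,x_n\in\Omega$ the vector $(g(x_1),\dots,g(x_n))$ is multivariate Gaussian with mean $0$ and covariance matrix $(K(x_i,x_j))_{i,j}$. The squared exponential kernel with length-scale $\ell>0$ is $K_{SE}(x,y)=\frac{1}{\ell\sqrt{2\pi}}\exp\left(-(x-y)^2/(2\ell^2)\right)$. The continuous Hutchinson's estimate with $m$ probe functions drawn from $\mathcal{GP}(0,K)$ is $H_m(f)=\frac1m\sum_{i=1}^m\int_\Omega\int_\Omega g_i(x)f(x,y)g_i(y)\,dx\,dy$, where $g_1,\dots,g_m$ are independent draws from $\mathcal{GP}(0,K)$. *)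

(* Defs.v *)
From HB Require Import structures.
From mathcomp Require Import all_boot all_order all_algebra.
From mathcomp Require Import all_classical all_reals all_analysis.
Import Order.TTheory GRing.Theory Num.Theory.
Import numFieldNormedType.Exports.

Set Implicit Arguments.
Unset Strict Implicit.
Unset Printing Implicit Defensive.

Local Open Scope classical_set_scope.
Local Open Scope ring_scope.

Section kernels.
Context {R : realType}.
Implicit Types (Omega : set R) (f : R * R -> R).

Definition trace Omega f : R := \int[lebesgue_measure]_(x in Omega) f (x, x).

Definition L2norm Omega f : R :=
  fine ('N[lebesgue_measure \x lebesgue_measure]_2%:E
          [EFin \o (f \_ (Omega `*` Omega))])%E.

(* The supremum is a maximum when [f] is continuous and [Omega] is compact. *)
Definition maxnorm Omega f : R := sup [set `|f z| | z in Omega `*` Omega].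

Definition kernelSE (ell : R) (x y : R) : R :=
  (ell * Num.sqrt (2 * pi))^-1 * expR (- (x - y) ^+ 2 / (2 * ell ^+ 2)).

End kernels.

Section gaussian_processes.
Context {R : realType} {d : measure_display} {T : measurableType d}.
Variable P : probability T R.

(* Point masses are included separately: [normal_prob m 0] is the uniform law on
   [0, 1], not the Dirac measure at [m]. *)
Definition normal_variable (X : T -> R) : Prop :=
  measurable_fun setT X /\
  ((exists m : R, forall A : set R, measurable A ->
      pushforward P X A = \d_m A) \/
   (exists m s : R, 0 < s /\ forall A : set R, measurable A ->
      pushforward P X A = normal_prob m s A)).

(* A random vector is Gaussian when all linear combinations of its entries are
   normal; the covariance matrix may be singular. *)
Definition multivariate_normal n (X : 'I_n -> T -> R)
    (mean : 'rV[R]_n) (cov : 'M[R]_n) : Prop :=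
  [/\ forall t : 'I_n -> R, normal_variable (fun w => \sum_(i < n) t i * X i w),
      forall i, ('E_P[X i] = (mean 0 i)%:E)%E &
      forall i j, (covariance P (X i) (X j) = (cov i j)%:E)%E].

(* [g ~ GP(0, K)] on [Omega]; the values of [g] outside [Omega] are
   irrelevant. *)
Definition gaussian_process (Omega : set R) (K : R -> R -> R)
    (g : R -> T -> R) : Prop :=
  forall n (x : 'I_n -> R), (forall i, Omega (x i)) ->
    multivariate_normal (fun i => g (x i)) 0 (\matrix_(i, j) K (x i) (x j)).

(* This holds for every process with continuous sample paths on an interval
   [Omega]; it makes integrals of the sample paths meaningful. *)
Definition jointly_measurable (Omega : set R) (g : R -> T -> R) : Prop :=
  measurable_fun ([set: T] `*` Omega) (fun p : T * R => g p.2 p.1).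

Definition process_sigma_algebra (Omega : set R) (g : R -> T -> R) :
    set (set T) :=
  <<s [set E | exists x (B : set R),
         [/\ Omega x, measurable B & E = g x @^-1` B]] >>.

Definition independent_processes (Omega : set R) m
    (g : 'I_m -> R -> T -> R) : Prop :=
  forall (J : {set 'I_m}) (E : 'I_m -> set T),
    (forall i, i \in J -> process_sigma_algebra Omega (g i) (E i)) ->
    P (\bigcap_(i in [set` J]) E i) = (\prod_(i in J) P (E i))%E.

Definition hutchinson (Omega : set R) m (g : 'I_m -> R -> T -> R)
    (f : R * R -> R) (w : T) : R :=
  m%:R^-1 * \sum_(i < m)
    \int[lebesgue_measure]_(y in Omega)
      \int[lebesgue_measure]_(x in Omega) (g i x w * f (x, y) * g i y w).

End gaussian_processes.

(* Division is that of [\bar R], where [d / 0 = +oo]: the first entry imposes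
   no constraint when the argument of the square root is [<= 0]. When [f] is
   zero on [Omega], the second entry is [0] and no [ell > 0] is admissible. *)
Definition lengthscale_bound {R : realType} (a b eps d : R) (f : R * R -> R) :
    \bar R :=
  let N := L2norm `[a, b] f in
  let M := maxnorm `[a, b] f in
  Order.min
    (d%:E / (Num.sqrt (2 * ln (8 * M * (b - a) / (eps * N))))%:E)%E
    ((5 * eps * N)%:E / (26 * M)%:E)%E.

(* Main.v *)
(* With [t = eps * N], Fubini and [E (g x * g y) = K x y] reduce the claim to
   [|int int f K - tr f| < t].  The kernel [K x] is the normal density centred
   at [x], so for fixed [x] the difference [int f(x, y) K(x, y) dy - f(x, x)]
   is the integral over the whole line of [(f(x, y) - f(x, x)) K(x, y)], with
   [f(x, y) = 0] for [y] outside [a, b].  It is at most [t / (4 (b - a))] from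
   [|x - y| < d], plus [2 M exp(- d^2 / (2 ell^2)) <= t / (4 (b - a))] from the
   other [y] in [a, b], plus the mass of [K x] outside [a, b] times [M].  That
   mass is at most [ell sqrt(2 pi) / 2] times the sum of the normal densities
   centred at [a] and [b], taken at [x]; the integral of this sum over [a, b] is
   at most [1], which contributes
   [M ell sqrt(2 pi) / 2 <= 3/2 * 5 t / 26 < t / 2]. *)
Require Import Defs.
From HB Require Import structures.
From mathcomp Require Import all_boot all_order all_algebra.
From mathcomp Require Import all_classical all_reals all_analysis.
From mathcomp Require Import measurable_realfun ring lra.
Import Order.TTheory GRing.Theory Num.Theory.
Import numFieldNormedType.Exports.

Local Open Scope classical_set_scope.
Local Open Scope ring_scope.

(** * Measurability of continuous functions on the plane *)

(** The squares with rational centre and rational radius form a countable base of the plane, and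
    each is a measurable rectangle. *)
Lemma open_measurable_prod {R : realType} (A : set (R * R)) :
  open A -> measurable A.
Proof.
move=> oA.
pose B (q : rat * rat * rat) : set (R * R) :=
  ball (ratr q.1.1 : R) (ratr q.2) `*` ball (ratr q.1.2 : R) (ratr q.2).
have -> : A = \bigcup_q (if `[< B q `<=` A >] then B q else set0).
  apply/seteqP; split => [[x y] Axy|z [q _]]; last first.
    by case: ifPn => // /asboolP; exact.
  have /nbhs_ballP[e /= e0 eA] : nbhs (x, y) A by exact: open_nbhs_nbhs.
  (* With radius [r < e / 2] and a rational centre within [r] of [(x, y)] in each coordinate, every
     point of the square is within [2 r < e] of [(x, y)]. *)
  have [r] : exists r : rat, ratr r \in `]0, (e / 2 : R)[.
    by apply: rat_in_itvoo; rewrite divr_gt0.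
  rewrite in_itv/= => /andP[r0 re].
  have near_rat (u : R) : exists p : rat, `|ratr p - u| < ratr r.
    have [p] : exists p : rat, ratr p \in `]u, u + ratr r[.
      by apply: rat_in_itvoo; rewrite ltrDl.
    rewrite in_itv/= => /andP[p1 p2]; exists p.
    by rewrite ger0_norm ?subr_ge0 1?ltW// ltrBlDl.
  have [[p hp] [q hq]] := (near_rat x, near_rat y).
  exists ((p, q), r) => //; rewrite ifT//.
  apply/asboolP => -[u v] [/= pu qv]; apply: eA; split => /=.
  - rewrite /ball/= in pu *; rewrite distrC in hp.
    rewrite (le_lt_trans (ler_distD (ratr p) _ _))// (splitr e).
    by rewrite ltrD// (lt_trans _ re).
  - rewrite /ball/= in qv *; rewrite distrC in hq.
    rewrite (le_lt_trans (ler_distD (ratr q) _ _))// (splitr e).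
    by rewrite ltrD// (lt_trans _ re).
apply: countable_bigcupT_measurable; first exact: countableP.
move=> q; case: ifPn => // _.
by apply: measurableX; exact: measurable_ball.
Qed.

Lemma within_continuous_measurable_prod {R : realType} (D : set (R * R))
    (f : R * R -> R) :
  measurable D -> {within D, continuous f} -> measurable_fun D f.
Proof.
move=> mD /continuousP cf; apply: (measurability _ (RGenOpens.measurableE R)).
move=> _ [_ [a [b ->] <-]].
have /open_subspaceP[V oV VD] : open (f @^-1` `]a, b[ : set (subspace D)).
  exact/cf/interval_open.
by rewrite setIC -VD; apply: measurableI => //; exact: open_measurable_prod.
Qed.

(** * Half-line masses and shifts of normal densities *)

(** Substitution of [2 * c - x] for [x], which fixes [c] and preserves the density. *)
Lemma normal_pdf_reflect {R : realType} (c s : R) : s != 0 ->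
  (\int[lebesgue_measure]_(x in `]-oo, c]) (normal_pdf c s x)%:E =
   \int[lebesgue_measure]_(x in `[c, +oo[) (normal_pdf c s x)%:E)%E.
Proof.
move=> s0.
have Fc : (fun x => 2 * c - x) c = c by ring.
have DF : derive1 (fun x : R => 2 * c - x) = cst (- 1).
  by apply/funext => x; rewrite derive1E derive_val add0r mul1r.
rewrite -{1}Fc.
rewrite (@decreasing_ge0_integration_by_substitutiony _ (fun x => 2 * c - x))
  ?DF//; last first.
- by move=> x _; exact: normal_pdf_ge0.
- by apply: continuous_subspaceT => x; exact: continuous_normal_pdf.
- apply/cvgrNyPle => A; near=> x.
  suff : 2 * c - A <= x by lra.
  by near: x; apply: nbhs_pinfty_ge; rewrite num_real.
- split=> //.
 + by apply: cvgD; [exact: cvg_cst|apply: cvgN; exact: cvg_at_right_filter].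
- exact: is_cvg_cst.
- exact: is_cvg_cst.
- by move=> x _; exact: cst_continuous.
- by move=> x y _ _ xy; rewrite ltrD2l ltrN2.
apply: eq_integral => x _; rewrite !fctE opprK mulr1; congr (_%:E).
have sqE (y : R) : (2 * c - y - c) ^+ 2 = (y - c) ^+ 2 by ring.
by rewrite !normal_pdfE// /normal_fun sqE.
Unshelve. all: by end_near. Qed.

Lemma normal_pdf_half {R : realType} (c s : R) : s != 0 ->
  (\int[lebesgue_measure]_(x in `[c, +oo[) (normal_pdf c s x)%:E = (2^-1)%:E)%E /\
  (\int[lebesgue_measure]_(x in `]-oo, c]) (normal_pdf c s x)%:E = (2^-1)%:E)%E.
Proof.
move=> s0; rewrite normal_pdf_reflect//.
suff H : (\int[lebesgue_measure]_(x in `[c, +oo[) (normal_pdf c s x)%:E =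
  (2^-1)%:E)%E by [].
have mn D : measurable_fun D (fun x => (normal_pdf c s x)%:E).
  by apply/measurable_EFinP; apply: measurable_funTS; exact: measurable_normal_pdf.
have : (\int[lebesgue_measure]_(x in `]-oo, c]) (normal_pdf c s x)%:E +
  \int[lebesgue_measure]_(x in `]c, +oo[) (normal_pdf c s x)%:E = 1)%E.
  rewrite -(integral_normal_pdf c s) -ge0_integral_setU//=.
  - by rewrite -setCitvl setUv.
  - exact: mn.
  - by move=> x _; rewrite lee_fin normal_pdf_ge0.
  - apply/disj_setPS => x [] /=; rewrite !in_itv/= andbT => xc.
    by rewrite ltNge xc.
(* A single point has no mass, so both summands become the same integral; their sum [1] rules out
   infinite values. *)
rewrite integral_itv_obnd_cbnd// normal_pdf_reflect//.
case: (integral _ _ _) => [r||] //=; rewrite -EFinD => -[rE].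
by congr _%:E; lra.
Qed.

Lemma kernelSE_normal_pdf {R : realType} (s x y : R) : 0 < s ->
  kernelSE s x y = normal_pdf x s y.
Proof.
move=> s0; rewrite normal_pdfE ?gt_eqF// /kernelSE /normal_peak /normal_fun.
rewrite -(mulrnAr (s ^+ 2)) (sqrtrM (pi *+ 2)) ?sqr_ge0// sqrtr_sqr gtr0_norm//.
rewrite (_ : (x - y) ^+ 2 = (y - x) ^+ 2); last by ring.
by rewrite mulr_natl (mulr_natl (s ^+ 2)).
Qed.

(** The boundary weights of the smoothing error are exponentials in [x]; read as multiples of normal
    densities, they can be integrated over [x] as well. *)
Lemma kernelSEE {R : realType} (s x y : R) : 0 < s ->
  expR (- (x - y) ^+ 2 / (2 * s ^+ 2)) = s * Num.sqrt (2 * pi) * normal_pdf x s y.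
Proof.
move=> s0; rewrite -kernelSE_normal_pdf// /kernelSE mulVKf//.
by rewrite gt_eqF// mulr_gt0// sqrtr_gt0 mulr_gt0// pi_gt0.
Qed.

(* When [q] lies between [p] and [y], the squares satisfy
   [(y - p)^2 >= (q - p)^2 + (y - q)^2]. *)
Lemma normal_pdf_shift_le {R : realType} (s p q y : R) : 0 < s ->
  0 <= (y - q) * (q - p) ->
  normal_pdf p s y <= expR (- (q - p) ^+ 2 / (2 * s ^+ 2)) * normal_pdf q s y.
Proof.
move=> s0 yqp; rewrite -!kernelSE_normal_pdf// /kernelSE (mulrCA (expR _)) -expRD.
rewrite ler_pM2l; last by rewrite invr_gt0 mulr_gt0// sqrtr_gt0 mulr_gt0// pi_gt0.
rewrite ler_expR -mulrDl ler_pM2r; last by rewrite invr_gt0 mulr_gt0 ?exprn_gt0.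
by nra.
Qed.

(** * Nonnegative majorants with a bounded integral *)

(** The three facts needed of a dominating function are bundled, so that a majorant and its total
    mass are built together from sums and multiples. *)
Definition mass_le {R : realType} (g : R -> R) (c : R) :=
  [/\ measurable_fun setT g, (forall x, 0 <= g x) &
      (\int[lebesgue_measure]_x (g x)%:E <= c%:E)%E].

Lemma mass_leD {R : realType} (g h : R -> R) (c e : R) :
  mass_le g c -> mass_le h e -> mass_le (fun x => g x + h x) (c + e).
Proof.
move=> [mg g0 gc] [mh h0 he]; split; first exact: measurable_funD.
  by move=> x; rewrite addr_ge0.
under eq_integral do rewrite EFinD.
rewrite ge0_integralD//; last 4 first.
- by move=> x _; rewrite lee_fin.
- exact/measurable_EFinP.
- by move=> x _; rewrite lee_fin.
- exact/measurable_EFinP.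
by rewrite EFinD; exact: leeD.
Qed.

Lemma mass_leZ {R : realType} (k : R) (g : R -> R) (c : R) : 0 <= k ->
  mass_le g c -> mass_le (fun x => k * g x) (k * c).
Proof.
move=> k0 [mg g0 gc]; split; first exact: measurable_funM.
  by move=> x; rewrite mulr_ge0.
under eq_integral do rewrite EFinM.
rewrite ge0_integralZl_EFin//; last 2 first.
- by move=> x _; rewrite lee_fin.
- exact/measurable_EFinP.
by rewrite EFinM; rewrite lee_wpmul2l ?lee_fin.
Qed.

Lemma mass_le_normal_pdf {R : realType} (c s : R) : mass_le (normal_pdf c s) 1.
Proof.
by split; [exact: measurable_normal_pdf|exact: normal_pdf_ge0|
  rewrite integral_normal_pdf].
Qed.

Lemma mass_le_restrict {R : realType} (g : R -> R) (D : set R) (c : R) :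
  measurable D -> measurable_fun setT g -> (forall x, 0 <= g x) ->
  (\int[lebesgue_measure]_(x in D) (g x)%:E <= c%:E)%E ->
  mass_le (g \_ D) c.
Proof.
move=> mD mg g0 gc; split.
- by apply/(measurable_restrictT _ _).1 => //; exact: measurable_funTS.
- by move=> x; rewrite patchE; case: ifPn.
- by rewrite integral_mkcond in gc; rewrite restrict_EFin in gc.
Qed.

(** * Smoothing by a normal density: error at a point *)

(** The density [normal_pdf x s] has mass one, so the error is the integral of
    [(phi y - v) * normal_pdf x s y]. Each tail of this density beyond a point [q] lies below a half
    density centred at [q], scaled by the exponential decay from [x] to [q]; here [q] is [x + d],
    [x - d], [a] or [b]. *)
Lemma normal_smoothing_error {R : realType} (phi : R -> R) (a b x s d v M eta : R) :
  0 < s -> 0 < d -> x \in `[a, b] -> 0 <= eta ->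
  measurable_fun setT phi -> (forall y, `|phi y| <= M) -> `|v| <= M ->
  (forall y, y \notin `[a, b] -> phi y = 0) ->
  (forall y, y \in `[a, b] -> `|x - y| < d -> `|phi y - v| <= eta) ->
  (`| (\int[lebesgue_measure]_y (phi y * normal_pdf x s y)%:E) - v%:E | <=
   (eta + 2 * M * expR (- d ^+ 2 / (2 * s ^+ 2)) +
    M / 2 * (expR (- (a - x) ^+ 2 / (2 * s ^+ 2)) +
             expR (- (b - x) ^+ 2 / (2 * s ^+ 2))))%:E)%E.
Proof.
move=> s0 d0; rewrite in_itv/= => /andP[ax xb] eta0 mphi phiM vM phi0 phiv.
have M0 : 0 <= M := le_trans (normr_ge0 _) vM.
have sneq0 : s != 0 by rewrite gt_eqF.
have mn c : measurable_fun [set: R] (normal_pdf c s) := measurable_normal_pdf c s.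
have n0 c y : 0 <= normal_pdf c s y := normal_pdf_ge0 c s y.
have bounded_integrable (h : R -> R) k : measurable_fun [set: R] h ->
    (forall y, `|h y| <= k) ->
    lebesgue_measure.-integrable setT (fun y => (h y * normal_pdf x s y)%:E).
  move=> mh hk.
  apply: le_integrable (integrableZl measurableT k (integrable_normal_pdf x s)) => //.
  - by apply/measurable_EFinP; apply: measurable_funM; [exact: mh|exact: mn].
  - move=> y _; rewrite -EFinM !abse_EFin lee_fin !normrM ler_wpM2r//.
    exact: le_trans (hk y) (ler_norm _).
set e := expR (- d ^+ 2 / _); set ea := expR (- (a - x) ^+ 2 / _).
set eb := expR (- (b - x) ^+ 2 / _).
(* The upper and lower halves of the density centred at [c], each of mass [1/2]. *)
pose up c : R -> R := normal_pdf c s \_ `[c, +oo[.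
pose dn c : R -> R := normal_pdf c s \_ `]-oo, c].
have upE c y : c <= y -> up c y = normal_pdf c s y.
  by move=> cy; rewrite /up patchE mem_set//= in_itv/= cy.
have dnE c y : y <= c -> dn c y = normal_pdf c s y.
  by move=> cy; rewrite /dn patchE mem_set//= in_itv/= cy.
have upm c : mass_le (up c) 2^-1.
  by apply: mass_le_restrict => //; have [-> _] := normal_pdf_half c s sneq0.
have dnm c : mass_le (dn c) 2^-1.
  by apply: mass_le_restrict => //; have [_ ->] := normal_pdf_half c s sneq0.
have [e0 ea0 eb0] : [/\ 0 <= e, 0 <= ea & 0 <= eb] by split; exact: expR_ge0.
have [Me Mea Meb] : [/\ 0 <= 2 * M * e, 0 <= M * ea & 0 <= M * eb].
  by rewrite !mulr_ge0.
(* The summands dominate, in turn, the integrand at [y] in [[a, b]] near [x], at [y] in [[a, b]] at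
   distance at least [d] from [x], below [a], and above [b]. The factor [2 * M] bounds [phi y - v];
   outside [[a, b]] only [v] remains, whence [M]. *)
have [mG G0 GE] : mass_le (fun y => eta * normal_pdf x s y +
    (2 * M * e * (up (x + d) y + dn (x - d) y) +
    (M * ea * dn a y + M * eb * up b y)))
    (eta * 1 + (2 * M * e * (2^-1 + 2^-1) + (M * ea * 2^-1 + M * eb * 2^-1))).
  apply: mass_leD; first exact: mass_leZ (mass_le_normal_pdf _ _).
  apply: mass_leD.
    by apply: mass_leZ; [|exact: mass_leD].
  by apply: mass_leD; apply: mass_leZ.
rewrite EFinN.
have <- : (\int[lebesgue_measure]_y (v * normal_pdf x s y)%:E = v%:E)%E.
  under eq_integral do rewrite EFinM.
  by rewrite integralZl ?integral_normal_pdf ?mule1//; exact: integrable_normal_pdf.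
rewrite -integralB//; last 2 first.
- exact: bounded_integrable mphi phiM.
- by apply: (bounded_integrable (cst v) M) => //; exact: measurable_cst.
have mdiff : measurable_fun [set: R]
    (fun y => (phi y * normal_pdf x s y)%:E - (v * normal_pdf x s y)%:E)%E.
  apply: emeasurable_funB; apply/measurable_EFinP; apply: measurable_funM => //.
apply: (le_trans (le_abse_integral _ _ _)) => //.
have -> : eta + 2 * M * e + M / 2 * (ea + eb) =
    eta * 1 + (2 * M * e * (2^-1 + 2^-1) + (M * ea * 2^-1 + M * eb * 2^-1)).
  by field.
apply: le_trans GE.
apply: ge0_le_integral => //.
- by apply: measurableT_comp => //; exact: mdiff.
- exact/measurable_EFinP.
move=> y _; rewrite -EFinB abse_EFin lee_fin -mulrBl normrM (ger0_norm (n0 _ _)).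
have [_ up0 _] := upm (x + d); have [_ dn0 _] := dnm (x - d).
have [_ upb0 _] := upm b; have [_ dna0 _] := dnm a.
have [yab|yab] := boolP (y \in `[a, b]).
  have [xyd|dxy] := ltP `|x - y| d.
    rewrite ler_wpDr//; last by rewrite ler_wpM2r// phiv.
    by rewrite !addr_ge0// mulr_ge0// addr_ge0.
  rewrite ler_wpDl//; first by rewrite mulr_ge0.
  rewrite ler_wpDr//; first by rewrite addr_ge0// mulr_ge0.
  apply: (@le_trans _ _ (2 * M * normal_pdf x s y)).
    rewrite ler_wpM2r// (le_trans (ler_normB _ _))// mulr_natl mulr2n.
    by rewrite lerD.
  rewrite -(mulrA (2 * M)) ler_wpM2l ?mulr_ge0//.
  have [xy|yx] := leP x y.
    have dxy' : x + d <= y by rewrite distrC ger0_norm ?subr_ge0// in dxy; lra.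
    rewrite mulrDr ler_wpDr ?mulr_ge0//.
    have := @normal_pdf_shift_le _ s x (x + d) y s0.
    rewrite upE// (_ : x + d - x = d); last by ring.
    by apply; rewrite mulr_ge0 ?subr_ge0// ltW.
  have dxy' : y <= x - d by rewrite gtr0_norm ?subr_gt0// in dxy; lra.
  rewrite mulrDr ler_wpDl ?mulr_ge0//.
  have := @normal_pdf_shift_le _ s x (x - d) y s0.
  rewrite dnE// (_ : x - d - x = - d) ?sqrrN; last by ring.
  by apply; rewrite mulr_le0 ?subr_le0// oppr_le0 ltW.
rewrite phi0// sub0r normrN.
rewrite ler_wpDl//; first by rewrite mulr_ge0.
rewrite ler_wpDl//; first by rewrite mulr_ge0// ?addr_ge0.
move: yab; rewrite in_itv/= negb_and -!ltNge => /orP[ya|yb].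
  rewrite ler_wpDr ?mulr_ge0// -mulrA ler_pM// (dnE _ _ (ltW ya)).
  by apply: normal_pdf_shift_le => //; rewrite mulr_le0// subr_le0// ltW.
rewrite ler_wpDl ?mulr_ge0// -mulrA ler_pM// (upE _ _ (ltW yb)).
by apply: normal_pdf_shift_le => //; rewrite mulr_ge0// subr_ge0// ltW.
Qed.

(** * The length-scale condition without divisions *)

(** With [L = 8 * M * (b - a) / (eps * N)], squaring [ell * sqrt (2 ln L) < d] gives
    [ln L <= d^2 / (2 ell^2)], so the Gaussian factor at distance [d] is at most [1 / L]. *)
Lemma lt_lengthscale_bound {R : realType} (a b eps d ell : R) (f : R * R -> R)
    (N := L2norm `[a, b] f) (M := maxnorm `[a, b] f) :
  a < b -> 0 < eps -> 0 < d -> 0 < ell -> 0 <= M ->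
  (ell%:E < lengthscale_bound a b eps d f)%E ->
  [/\ 0 < N, 8 * M * (b - a) * expR (- d ^+ 2 / (2 * ell ^+ 2)) <= eps * N &
      26 * M * ell <= 5 * eps * N].
Proof.
move=> ab eps0 d0 ell0 M0.
rewrite /lengthscale_bound -/N -/M lt_min => /andP[elld ellM].
have N0 : 0 < N.
  rewrite lt_neqAle eq_sym fine_ge0 ?Lnorm_ge0// andbT; apply/eqP => N0.
  (* If [N = 0], the second entry is [0] times an inverse, which is [0] even when that inverse is
     infinite; this contradicts [0 < ell]. *)
  by move: ellM; rewrite N0 mulr0 mul0e lte_fin ltNge ltW.
have [M_eq0|M_neq0] := eqVneq M 0.
  by rewrite M_eq0 !(mulr0, mul0r) !mulr_ge0 ?(ltW eps0) ?(ltW N0).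
have M_gt0 : 0 < M by rewrite lt_neqAle eq_sym M_neq0.
have ba : 0 < b - a by rewrite subr_gt0.
split => //.
- set L := 8 * M * (b - a) / (eps * N) in elld.
  have L0 : 0 < L by rewrite divr_gt0 ?mulr_gt0.
  suff : expR (- d ^+ 2 / (2 * ell ^+ 2)) <= L^-1.
    rewrite /L invf_div ler_pdivlMr; last by rewrite !mulr_gt0.
    by rewrite mulrC.
  (* When [ln L <= 0] the first entry is infinite and says nothing, but then [L <= 1] and the
     exponential is at most [1 <= 1 / L]. *)
  have [L1|L1] := leP (ln L) 0.
    apply: (@le_trans _ _ 1).
      rewrite -expR0 ler_expR mulNr oppr_le0 divr_ge0 ?sqr_ge0//.
      by rewrite mulr_ge0 ?sqr_ge0.
    rewrite invf_ge1//.
    by rewrite -ler_expR expR0 lnK// in L1.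
  have sq0 : 0 < Num.sqrt (2 * ln L) by rewrite sqrtr_gt0 mulr_gt0.
  rewrite inver gt_eqF// -EFinM lte_fin ltr_pdivlMr// in elld.
  rewrite -[leRHS]lnK ?posrE ?invr_gt0// ler_expR lnV ?posrE// mulNr lerN2.
  rewrite ler_pdivlMr ?mulr_gt0// ?exprn_gt0//.
  have /ltW : (ell * Num.sqrt (2 * ln L)) ^+ 2 < d ^+ 2.
    by rewrite ltr_pXn2r// nnegrE ltW// mulr_gt0.
  rewrite exprMn sqr_sqrtr; last by rewrite mulr_ge0// ltW.
  by lra.
- have M26 : 26 * M != 0 by rewrite mulf_neq0.
  rewrite inver (negbTE M26) -EFinM lte_fin ltr_pdivlMr ?mulr_gt0// in ellM.
  by rewrite mulrC ltW.
Qed.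

(** * Smoothing error integrated along the diagonal *)

Lemma measurable_normal_pdf2 {R : realType} (s : R) : 0 < s ->
  measurable_fun [set: R * R] (fun z : R * R => normal_pdf z.1 s z.2).
Proof.
move=> s0.
have -> : (fun z : R * R => normal_pdf z.1 s z.2) =
    (fun z => normal_peak s * expR (- (z.2 - z.1) ^+ 2 * (s ^+ 2 *+ 2)^-1)).
  by apply/funext => z; rewrite normal_pdfE ?gt_eqF.
apply: measurable_funM => //; apply: measurableT_comp => //.
apply: measurable_funM => //; apply: measurableT_comp => //.
apply: measurable_funX.
by apply: measurable_funB; [exact: measurable_snd|exact: measurable_fst].
Qed.

(** Domination by the multiple [k] of the indicator of [D], a set of finite measure. *)
Lemma bounded_support_integrable {d} {T : measurableType d} {R : realType}
    (mu : {measure set T -> \bar R}) (D : set T) (h : T -> R) (k : R) :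
  measurable D -> (mu D < +oo)%E -> measurable_fun setT h ->
  (forall x, `|h x| <= k) -> (forall x, ~ D x -> h x = 0) ->
  mu.-integrable setT (EFin \o h).
Proof.
move=> mD muD mh hk h0.
have : mu.-integrable setT (fun x => k%:E * (\1_D x)%:E)%E.
  apply: integrableZl => //; apply/integrableP; split.
    exact/measurable_EFinP/measurable_indic.
  under eq_integral do rewrite abse_EFin ger0_norm//.
  by rewrite integral_indic// setIT.
apply: le_integrable => //; first exact/measurable_EFinP.
move=> x _; rewrite -EFinM !abse_EFin lee_fin indicE.
have [Dx|nDx] := boolP (x \in D).
  by rewrite mulr1; exact: le_trans (hk x) (ler_norm _).
rewrite h0 ?normr0 ?mulr0 ?normr0// => Dx.
by rewrite mem_set in nDx.
Qed.

(** The pointwise error is integrated over [x]. Its boundary terms do not become small near [a] and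
    [b], but as functions of [x] they are [s * sqrt (2 * pi)] times normal densities centred at [a]
    and [b], so their integrals are of order [s]. *)
Lemma normal_smoothing_trace_error {R : realType} (F : R * R -> R)
    (a b s d M eta : R) :
  a < b -> 0 < s -> 0 < d -> 0 <= eta ->
  measurable_fun setT F -> (forall z, `|F z| <= M) ->
  (forall z, ~ (`[a, b] `*` `[a, b]) z -> F z = 0) ->
  (forall x y, x \in `[a, b] -> y \in `[a, b] -> `|x - y| < d ->
    `|F (x, y) - F (x, x)| <= eta) ->
  (`| (\int[lebesgue_measure]_y \int[lebesgue_measure]_x
        (F (x, y) * normal_pdf x s y)%:E) -
      (\int[lebesgue_measure]_x (F (x, x))%:E) | <=
   ((b - a) * (eta + 2 * M * expR (- d ^+ 2 / (2 * s ^+ 2))) +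
    M / 2 * (s * Num.sqrt (2 * pi)))%:E)%E.
Proof.
move=> ab s0 d0 eta0 mF FM F0 Fd.
have M0 : 0 <= M := le_trans (normr_ge0 _) (FM (0, 0)).
have sneq0 : s != 0 by rewrite gt_eqF.
have lab : lebesgue_measure `[a, b]%classic = (b - a)%:E.
  by rewrite lebesgue_measure_itv/= lte_fin ab -EFinB.
have mab : measurable (`[a, b]%classic : set R) by [].
have mFn : measurable_fun [set: R * R] (fun z => F z * normal_pdf z.1 s z.2).
  by apply: measurable_funM => //; exact: measurable_normal_pdf2.
have iFn : (lebesgue_measure \x lebesgue_measure)%E.-integrable setT
    (fun z : R * R => (F z * normal_pdf z.1 s z.2)%:E).
  pose mu2 := [the measure _ _ of (@lebesgue_measure R \x @lebesgue_measure R)%E].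
  have := @bounded_support_integrable _ _ _ mu2 (`[a, b] `*` `[a, b])
    (fun z : R * R => F z * normal_pdf z.1 s z.2) (M * normal_peak s).
  apply => //.
  - exact: measurableX.
  - suff -> : mu2 (`[a, b] `*` `[a, b]) = ((b - a)%:E * (b - a)%:E)%E.
      by rewrite -EFinM ltry.
    by rewrite /mu2/= product_measure1E// -lab.
  - move=> z; rewrite normrM ler_pM// ger0_norm ?normal_pdf_ge0//.
    exact: normal_pdf_ub.
  - by move=> z /F0 ->; rewrite mul0r.
have iI := integrable_fubini_F iFn.
(* The integral over [y] becomes the inner one, so that for fixed [x] the smoothing kernel is a
   probability density in [y]. *)
rewrite -[X in (`|X - _| <= _)%E](Fubini iFn).
have mdiag : measurable_fun [set: R] (fun x => F (x, x)).
  by apply: (measurableT_comp mF); exact: measurable_fun_pair.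
have iD : lebesgue_measure.-integrable setT (fun x : R => (F (x, x))%:E).
  have := @bounded_support_integrable _ _ _ (@lebesgue_measure R) `[a, b]%classic
    (fun x => F (x, x)) M.
  apply => //.
  - by have := ltry (b - a); rewrite -lab.
  - by move=> x nx; apply: F0 => -[].
rewrite -integralB//.
apply: (le_trans (le_abse_integral _ _ _)) => //.
  by apply: emeasurable_funB; [exact: measurable_int iI|exact: measurable_int iD].
set e := expR _; set C := s * _.
have e0 : 0 <= e := expR_ge0 _.
have C0 : 0 <= C by rewrite mulr_ge0 ?sqrtr_ge0// ltW.
pose k := eta + 2 * M * e.
have k0 : 0 <= k by rewrite addr_ge0 ?mulr_ge0.
(* Points of [[a, b]] lie above [a] and below [b], so only one half of each boundary density counts;
   the two halves have total mass one. *)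
have [mG G0 GE] : mass_le (fun x => k * \1_`[a, b] x +
     M / 2 * (C * ((normal_pdf a s \_ `[a, +oo[) x +
                   (normal_pdf b s \_ `]-oo, b]) x)))
    (k * (b - a) + M / 2 * (C * (2^-1 + 2^-1))).
  have [ha _] := normal_pdf_half a s sneq0.
  have [_ hb] := normal_pdf_half b s sneq0.
  apply: mass_leD; apply: mass_leZ => //.
  - split; [exact: measurable_indic|by []|].
    by rewrite integral_indic// setIT -lab lexx.
  - by rewrite divr_ge0.
  - apply: mass_leZ => //; apply: mass_leD; apply: mass_le_restrict => //.
    + exact: measurable_normal_pdf.
    + exact: normal_pdf_ge0.
    + by rewrite ha.
    + exact: measurable_normal_pdf.
    + exact: normal_pdf_ge0.
    + by rewrite hb.
have -> : (b - a) * k + M / 2 * C =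
  k * (b - a) + M / 2 * (C * (2^-1 + 2^-1)) by field.
apply: le_trans GE.
apply: ge0_le_integral => //.
- apply: measurableT_comp => //.
  by apply: emeasurable_funB; [exact: measurable_int iI|exact: measurable_int iD].
- exact/measurable_EFinP.
move=> x _.
have [xab|xab] := boolP (x \in `[a, b]); last first.
  have nx y : F (x, y) = 0 by apply: F0 => -[h _]; exact: (negP xab).
  rewrite nx [X in (`|X - _|)%E](_ : _ = 0)%E; last first.
    by rewrite /fubini_F integral0_eq// => y _; rewrite nx mul0r.
  by rewrite sub0e abseN abse_EFin normr0 lee_fin.
have /andP[ax xb] : a <= x <= b by rewrite in_itv in xab.
have := @normal_smoothing_error R (fun y => F (x, y)) a b x s d (F (x, x)) M eta
  s0 d0 xab eta0.
rewrite (kernelSEE _ a x)// (kernelSEE _ b x)// -/e -mulrDr -/C => H.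
rewrite /patch !mem_set//= ?in_itv/= ?ax ?xb ?andbT//.
rewrite indicE mem_set// mulr1.
apply: H.
- by apply: (measurableT_comp mF); exact: measurable_fun_pair.
- by move=> y; exact: FM.
- exact: FM.
- by move=> y yab; apply: F0 => -[_ /=] ; apply/negP.
- by move=> y yab; exact: Fd.
Qed.

(** * Second moments and the expectation of a random quadratic form *)

(** Real-valued iterated integrals apply [fine] to the inner integral. That integral is finite
    almost everywhere, so the replacement of infinite values by [0] is harmless. *)
Lemma integral_fine_fubini_F {d1 d2} {T1 : measurableType d1}
    {T2 : measurableType d2} {R : realType} (m1 : {sigma_finite_measure set T1 -> \bar R})
    (m2 : {sigma_finite_measure set T2 -> \bar R}) (f : T1 * T2 -> \bar R) :
  (m1 \x m2)%E.-integrable setT f ->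
  m1.-integrable setT (fun x => (fine (\int[m2]_y f (x, y))%E)%:E) /\
  (\int[m1]_x (fine (\int[m2]_y f (x, y)))%:E = \int[m1 \x m2]_z f z)%E.
Proof.
move=> fi; have Fi := integrable_fubini_F fi.
have mF := measurable_int _ Fi.
have mfine : measurable_fun setT (fun x => (fine (fubini_F m2 f x))%:E).
  by apply/measurable_EFinP; apply: measurableT_comp mF.
have Fae : ae_eq m1 setT (fubini_F m2 f) (fun x => (fine (fubini_F m2 f x))%:E).
  by apply: filterS (integrable_ae measurableT Fi) => x + _ => /(_ I) /fineK ->.
split; last by rewrite -integral12_prod_meas1//; apply/esym/ae_eq_integral.
apply: le_integrable Fi => // x _; rewrite /fubini_F.
by case: (\int[m2]_y f (x, y))%E => [r||] //=; rewrite normr0 leey.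
Qed.

(** One-point vectors give measurability; two-point vectors give the covariance, which is the second
    moment because the mean is zero. *)
Lemma gaussian_process_moment {R : realType} {d} {T : measurableType d}
    (P : probability T R) (Omega : set R) (K : R -> R -> R)
    (g : R -> T -> R) (x y : R) :
  gaussian_process P Omega K g -> Omega x -> Omega y ->
  [/\ measurable_fun setT (g x), measurable_fun setT (g y) &
      (\int[P]_w (g x w * g y w)%:E = (K x y)%:E)%E].
Proof.
move=> gGP Ox Oy.
have mg z : Omega z -> measurable_fun setT (g z).
  move=> Oz; have [/(_ (fun=> 1)) [+ _] _ _] := gGP 1 (fun=> z) (fun=> Oz).
  by under eq_fun do rewrite big_ord1 mul1r.
split; [exact: mg|exact: mg|].
(* The points may coincide: [gaussian_process] allows repetitions. *)
pose xy (i : 'I_2) := if i == ord0 then x else y.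
have [] := gGP 2 xy; first by move=> i; rewrite /xy; case: ifP.
move=> _ Eg /(_ ord0 ord_max); rewrite mxE unlock.
have := Eg ord0; have := Eg ord_max; rewrite !mxE /xy/= => -> ->.
rewrite unlock => <-; apply: eq_integral => w _.
by rewrite fctE/= !subr0.
Qed.

(** Pointwise, [|u v| <= u^2 + v^2]. Only finiteness of the bound matters later, as domination for
    Fubini. *)
Lemma gaussian_process_absmoment {R : realType} {d} {T : measurableType d}
    (P : probability T R) (Omega : set R) (K : R -> R -> R)
    (g : R -> T -> R) (x y : R) :
  gaussian_process P Omega K g -> Omega x -> Omega y ->
  (\int[P]_w `|(g x w * g y w)%:E| <= (K x x)%:E + (K y y)%:E)%E.
Proof.
move=> gGP Ox Oy.
have [mx my _] := @gaussian_process_moment _ _ _ _ _ _ _ x y gGP Ox Oy.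
have [_ _ <-] := @gaussian_process_moment _ _ _ _ _ _ _ x x gGP Ox Ox.
have [_ _ <-] := @gaussian_process_moment _ _ _ _ _ _ _ y y gGP Oy Oy.
have msq (h : T -> R) : measurable_fun setT h ->
    measurable_fun setT (fun w : T => (h w * h w : R)%:E).
  by move=> mh; apply/measurable_EFinP; exact: measurable_funM.
rewrite -ge0_integralD//; last 4 first.
- by move=> w _; rewrite lee_fin -expr2 sqr_ge0.
- exact: msq.
- by move=> w _; rewrite lee_fin -expr2 sqr_ge0.
- exact: msq.
apply: ge0_le_integral => //.
- by apply: measurableT_comp => //; apply/measurable_EFinP; exact: measurable_funM.
- by apply: emeasurable_funD; exact: msq.
move=> w _; rewrite abse_EFin -EFinD lee_fin normrM.
rewrite -!expr2 -(real_normK (num_real (g x w))).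
by rewrite -(real_normK (num_real (g y w))); nra.
Qed.
(** Without integrability, Tonelli applies to the positive and negative parts, whose integrals
    define the integral by their difference. *)
Lemma measurable_fun_integral {d1 d2} {T1 : measurableType d1}
    {T2 : measurableType d2} {R : realType}
    (m2 : {sigma_finite_measure set T2 -> \bar R}) (f : T1 * T2 -> \bar R) :
  measurable_fun setT f -> measurable_fun setT (fun x => \int[m2]_y f (x, y))%E.
Proof.
move=> mf; have -> : (fun x => \int[m2]_y f (x, y))%E =
    (fun x => \int[m2]_y f^\+ (x, y) - \int[m2]_y f^\- (x, y))%E.
  apply/funext => x; rewrite [LHS]integralE.
  under eq_integral do rewrite funepos_comp/=.
  by under [X in (_ - X = _)%E]eq_integral do rewrite funeneg_comp/=.
apply: emeasurable_funB.
  by apply: measurable_fun_fubini_tonelli_F => //; exact: measurable_funepos.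
by apply: measurable_fun_fubini_tonelli_F => //; exact: measurable_funeneg.
Qed.

(** The expectation is moved inside one integral at a time: first past [y], then past [x] for fixed
    [y]. Both exchanges are justified by the bound [c] on absolute moments and the finite measure of
    [D]. *)
Lemma expectation_quadratic_form {R : realType} {d} {T : measurableType d}
    {d'} {X : measurableType d'} (P : probability T R)
    (mu : {sigma_finite_measure set X -> \bar R}) (D : set X) (G : T * X -> R)
    (F : X * X -> R) (K : X -> X -> R) (M c : R) :
  measurable D -> (mu D < +oo)%E ->
  measurable_fun setT G -> measurable_fun setT F -> (forall z, `|F z| <= M) ->
  (forall z, ~ (D `*` D) z -> F z = 0) -> 0 <= c ->
  (forall x y, D x -> D y ->
    (\int[P]_w `|(G (w, x) * G (w, y))%:E| <= c%:E)%E) ->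
  (forall x y, D x -> D y ->
    (\int[P]_w (G (w, x) * G (w, y))%:E = (K x y)%:E)%E) ->
  let Q w := \int[mu]_y \int[mu]_x
    (G (w, x) * F (x, y) * G (w, y)) in
  P.-integrable setT (EFin \o Q) /\
  (\int[P]_w (Q w)%:E = \int[mu]_y \int[mu]_x
    (F (x, y) * K x y)%:E)%E.
Proof.
move=> mD Dfin mG mF FM F0 c0 Gc GK Q.
have M0 : 0 <= M := le_trans (normr_ge0 _) (FM (point, point)).
pose h (z : (T * X) * X) : R :=
  G (z.1.1, z.2) * F (z.2, z.1.2) * G (z.1.1, z.1.2).
have mh : measurable_fun setT h.
  apply: measurable_funM; first apply: measurable_funM.
  - apply: (measurableT_comp mG); apply: measurable_fun_pair => //.
    exact: measurableT_comp.
  - apply: (measurableT_comp mF); apply: measurable_fun_pair => //.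
    exact: measurableT_comp.
  - apply: (measurableT_comp mG).
    by apply: measurable_fun_pair; exact: measurableT_comp.
have hF w y x : h ((w, y), x) = F (x, y) * (G (w, x) * G (w, y)).
  by rewrite /h/=; ring.
have mGG x y : measurable_fun setT (fun w => (G (w, x) * G (w, y))%:E).
  by apply/measurable_EFinP; apply: measurable_funM; apply: (measurableT_comp mG);
    exact: measurable_fun_pair.
(* The moment hypotheses hold only on [D]; elsewhere the factor [F] makes everything vanish. *)
have FD x y : F (x, y) != 0 -> D x /\ D y.
  by move=> Fxy; apply: contrapT => nD; move/eqP: Fxy; apply; apply: F0.
have habs y x : (\int[P]_w `|(h ((w, y), x))%:E| <= (M * c * \1_D x * \1_D y)%:E)%E.
  have [Fxy|/FD[Dx Dy]] := eqVneq (F (x, y)) 0.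
    rewrite integral0_eq; last by move=> w _; rewrite hF Fxy mul0r abse_EFin normr0.
    by rewrite lee_fin !mulr_ge0.
  rewrite !indicE !mem_set// !mulr1.
  under eq_integral do rewrite hF EFinM abseM.
  rewrite ge0_integralZl//; last exact: measurableT_comp.
  rewrite EFinM; apply: lee_pmul => //; [exact: integral_ge0|exact: FM|exact: Gc].
have hK y x : (\int[P]_w (h ((w, y), x))%:E = (F (x, y) * K x y)%:E)%E.
  have [Fxy|/FD[Dx Dy]] := eqVneq (F (x, y)) 0.
    by rewrite integral0_eq ?Fxy ?mul0r// => w _; rewrite hF Fxy mul0r.
  under eq_integral do rewrite hF EFinM.
  rewrite integralZl//.
    by rewrite GK.
  apply/integrableP; split => //.
  exact: le_lt_trans (Gc _ _ Dx Dy) (ltry _).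
have mhy y : measurable_fun setT (fun u : T * X => (h ((u.1, y), u.2))%:E).
  apply/measurable_EFinP; apply: (measurableT_comp mh).
  by apply: measurable_fun_pair => //; exact: measurable_fun_pair.
(* Bounds the absolute mass of [h] for fixed [y]; the factor [\1_D y] keeps its integral over [y]
   finite. *)
pose B y := (M * c * \1_D y * fine (mu D))%:E.
have habs2 y : (\int[mu]_x \int[P]_w `|(h ((w, y), x))%:E| <= B y)%E.
  apply: (@le_trans _ _ (\int[mu]_x (M * c * \1_D y * \1_D x)%:E)%E).
    apply: ge0_le_integral => //.
    - by move=> x _; exact: integral_ge0.
    - apply: (measurable_fun_fubini_tonelli_G
        (fun u : T * X => `|(h ((u.1, y), u.2))%:E|)%E) => //.
      exact: measurableT_comp.
    - by apply/measurable_EFinP; apply: measurable_funM => //; exact: measurable_indic.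
    - by move=> x _; rewrite mulrAC; exact: habs.
  under eq_integral do rewrite EFinM.
  rewrite ge0_integralZl_EFin//; last 2 first.
  - exact/measurable_EFinP/measurable_indic.
  - by rewrite !mulr_ge0.
  by rewrite integral_indic// setIT /B [leRHS]EFinM fineK// ge0_fin_numE.
have hy y : (P \x mu)%E.-integrable setT (fun u : T * X => (h ((u.1, y), u.2))%:E).
  by apply/integrable21ltyP => //; exact: le_lt_trans (habs2 y) (ltry _).
(* The inner real integral of [Q], as a function of the pair of sample point and [y]. *)
pose q (u : T * X) : R := fine (\int[mu]_x (h (u, x))%:E)%E.
have mq : measurable_fun setT q.
  apply: measurableT_comp => //.
  by apply: (measurable_fun_integral mu (EFin \o h)); exact/measurable_EFinP.
have qE y := integral_fine_fubini_F _ _ _ (hy y).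
have iq : (P \x mu)%E.-integrable setT (EFin \o q).
  have mEq : measurable_fun setT (EFin \o q) by exact/measurable_EFinP.
  apply/integrable21ltyP => //.
  apply: (@le_lt_trans _ _ (\int[mu]_y B y)%E); last first.
    rewrite /B; under eq_integral do rewrite mulrAC EFinM.
    rewrite ge0_integralZl_EFin//; last 2 first.
    - exact/measurable_EFinP/measurable_indic.
    - by rewrite !mulr_ge0// fine_ge0.
    by rewrite integral_indic// setIT lte_mul_pinfty// lee_fin !mulr_ge0// fine_ge0.
  apply: ge0_le_integral => //.
  - by move=> y _; exact: integral_ge0.
  - apply: (measurable_fun_fubini_tonelli_G (fun u => `|(q u)%:E|)%E) => //.
    exact: measurableT_comp.
  - apply/measurable_EFinP; apply: measurable_funM => //.
    by apply: measurable_funM => //; exact: measurable_indic.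
  move=> y _; apply: le_trans (habs2 y).
  rewrite -(fubini_tonelli (fun u : T * X => `|(h ((u.1, y), u.2))%:E|)%E)//;
    last exact: measurableT_comp.
  apply: ge0_le_integral => //.
  - by apply: measurableT_comp => //; exact: (measurable_int _ (qE y).1).
  - by apply: (measurable_fun_fubini_tonelli_F
      (fun u : T * X => `|(h ((u.1, y), u.2))%:E|)%E) => //;
      exact: measurableT_comp.
  move=> w _; apply: (@le_trans _ _ `|\int[mu]_x (h ((w, y), x))%:E|%E).
    by rewrite /q/=; case: (integral _ _ _) => [r||]//=; rewrite ?normr0 ?leey.
  apply: le_abse_integral => //.
  by apply/measurable_EFinP; apply: (measurableT_comp mh); exact: measurable_fun_pair.
have [iQ QE] := integral_fine_fubini_F _ _ _ iq.
split; first exact: iQ.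
rewrite [LHS]QE -integral21_prod_meas1//; apply: eq_integral => y _.
rewrite [LHS](qE y).2 -integral21_prod_meas1; last exact: hy.
by apply: eq_integral => x _; exact: hK.
Qed.

(** * Expectation of the estimate and the final bound *)

Lemma maxnorm_ub {R : realType} (D : set R) (f : R * R -> R) (z : R * R) :
  compact D -> {within D `*` D, continuous f} -> (D `*` D) z ->
  `|f z| <= maxnorm D f.
Proof.
move=> cD cf Dz; apply: ub_le_sup; last by exists z.
have /compact_bounded[k [_ fk]] := continuous_compact cf (compact_setX cD cD).
(* [compact_bounded] gives a bound by every number strictly above [k], hence [k + 1]. *)
exists (k + 1) => _ [u Du <-]; apply: (fk (k + 1)); first by rewrite ltrDl.
by exists u.
Qed.

(** By linearity the expectation is an average of [m] equal terms. The constant diagonal [k] of [K]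
    bounds all absolute moments by [k + k]. *)
Lemma expectation_hutchinson {R : realType} {d} {T : measurableType d}
    (P : probability T R) (D : set R) (f : R * R -> R) (K : R -> R -> R)
    (k M : R) m (g : 'I_m -> R -> T -> R) :
  measurable D -> (lebesgue_measure D < +oo)%E ->
  measurable_fun (D `*` D) f -> (forall z, (D `*` D) z -> `|f z| <= M) -> 0 <= M ->
  (forall x, K x x = k) -> 0 <= k -> (0 < m)%N ->
  (forall i, gaussian_process P D K (g i)) ->
  (forall i, jointly_measurable D (g i)) ->
  ('E_P[hutchinson D g f] = \int[lebesgue_measure]_y \int[lebesgue_measure]_x
    ((f \_ (D `*` D)) (x, y) * K x y)%:E)%E.
Proof.
move=> mD Dfin mf fM M0 Kk k0 m0 gGP gmeas.
have mDD : measurable (D `*` D) by exact: measurableX.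
have mTD : measurable ([set: T] `*` D) by exact: measurableX.
(* Values of [g i] outside [D] are arbitrary; extension by zero makes the process jointly measurable
   on the whole product. *)
pose G i : T * R -> R := (fun p => g i p.2 p.1) \_ ([set: T] `*` D).
have mG i : measurable_fun setT (G i) := (measurable_restrictT _ mTD).1 (gmeas i).
have GE i w x : D x -> G i (w, x) = g i x w by move=> Dx; rewrite /G patchE mem_set.
have G0 i w x : ~ D x -> G i (w, x) = 0.
  by move=> Dx; rewrite /G patchE memNset// => -[].
have mF : measurable_fun setT (f \_ (D `*` D)).
  exact: (measurable_restrictT f mDD).1 mf.
have FM z : `|(f \_ (D `*` D)) z| <= M.
  by rewrite patchE; case: ifPn => [/set_mem/fM //|_]; rewrite normr0.
have F0 z : ~ (D `*` D) z -> (f \_ (D `*` D)) z = 0.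
  by move=> nz; rewrite patchE memNset.
have key i := @expectation_quadratic_form R d T _ _ P (@lebesgue_measure R) D
  (G i) (f \_ (D `*` D)) K M (k + k)
  mD Dfin (mG i) mF FM F0 (addr_ge0 k0 k0).
set I := (RHS).
pose Q i w := \int[lebesgue_measure]_y \int[lebesgue_measure]_x
    (G i (w, x) * (f \_ (D `*` D)) (x, y) * G i (w, y)).
have QI i : P.-integrable setT (EFin \o Q i) /\ (\int[P]_w (Q i w)%:E = I)%E.
  apply: key => x y Dx Dy.
    under eq_integral do rewrite !GE//.
    have := gaussian_process_absmoment _ _ _ _ _ _ (gGP i) Dx Dy.
    by rewrite !Kk EFinD.
  under eq_integral do rewrite !GE//.
  by have [] := gaussian_process_moment _ _ _ _ _ _ (gGP i) Dx Dy.
have HQ w : hutchinson D g f w = m%:R^-1 * \sum_(i < m) Q i w.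
  congr (_ * _); apply: eq_bigr => i _.
  rewrite Rintegral_mkcond; apply: eq_Rintegral => y _.
  rewrite patchE; case: ifPn => [/set_mem Dy|/negP nDy]; last first.
    rewrite /Rintegral integral0_eq// => x _; rewrite (G0 _ _ y) ?mulr0// => Dy.
    exact: nDy (mem_set Dy).
  rewrite Rintegral_mkcond; apply: eq_Rintegral => x _.
  rewrite patchE; case: ifPn => [/set_mem Dx|/negP nDx]; last first.
    rewrite (G0 _ _ x) ?mul0r// => Dx.
    exact: nDx (mem_set Dx).
  by rewrite !GE// patchE mem_set.
rewrite unlock; under eq_integral do rewrite HQ EFinM -sumEFin.
(* Finiteness, read off any one probe, lets [m] copies of [I] cancel against the factor [1 / m]. *)
have Ifin : I \is a fin_num.
  by have [iQ <-] := QI (Ordinal m0); exact: integrable_fin_num.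
rewrite integralZl//; last by apply: integrable_sum => // i _; exact: (QI i).1.
rewrite integral_sum//; last by move=> i; exact: (QI i).1.
under eq_bigr do rewrite (QI _).2.
rewrite -(fineK Ifin) sumEFin sumr_const card_ord -EFinM.
rewrite -(mulr_natl (fine I)) mulKf//.
by rewrite pnatr_eq0 -lt0n.
Qed.

Theorem theorem4p1 (R : realType) (disp : measure_display)
  (T : measurableType disp) (P : probability T R)
  (a b : R) (hab : a < b)
  (f : R * R -> R)
  (hf : {within `[a, b]%classic `*` `[a, b]%classic, continuous f})
  (eps : R) (heps : 0 < eps)
  (d : R) (hd : 0 < d)
  (hfd : forall x y z : R, x \in `[a, b] -> y \in `[a, b] -> z \in `[a, b] ->
     `|y - z| < d ->
     `|f (x, y) - f (x, z)| <= eps * L2norm `[a, b] f / (4 * (b - a)))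
  (ell : R) (hell0 : 0 < ell)
  (hell : (ell%:E < lengthscale_bound a b eps d f)%E)
  (m : nat) (hm : (0 < m)%N)
  (g : 'I_m -> R -> T -> R)
  (hgGP : forall i, gaussian_process P `[a, b] (kernelSE ell) (g i))
  (hgmeas : forall i, jointly_measurable `[a, b] (g i))
  (hgindep : independent_processes P `[a, b] g) :
  (`| 'E_P[hutchinson `[a, b] g f] - (trace `[a, b] f)%:E |
     < (eps * L2norm `[a, b] f)%:E)%E.
Proof.
have mab : measurable (`[a, b]%classic : set R) by [].
have lab : lebesgue_measure `[a, b]%classic = (b - a)%:E.
  by rewrite lebesgue_measure_itv/= lte_fin hab -EFinB.
have fM z (zab : (`[a, b] `*` `[a, b]) z) : `|f z| <= maxnorm `[a, b] f :=
  maxnorm_ub _ _ _ (@segment_compact R a b) hf zab.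
set M := maxnorm `[a, b] f in fM.
have aab : a \in `[a, b] by rewrite in_itv/= lexx ltW.
have M0 : 0 <= M by apply: (le_trans (normr_ge0 _) (fM (a, a) _)).
have [N0 dN ellN] := lt_lengthscale_bound _ _ _ _ _ _ hab heps hd hell0 M0 hell.
rewrite -/M in dN ellN; set N := L2norm `[a, b] f in N0 dN ellN hfd *.
have mf : measurable_fun (`[a, b] `*` `[a, b]) f.
  by apply: within_continuous_measurable_prod => //; exact: measurableX.
have k0 : 0 <= (ell * Num.sqrt (2 * pi))^-1 :> R.
  by rewrite invr_ge0 mulr_ge0 ?sqrtr_ge0// ltW.
rewrite (@expectation_hutchinson R disp T P `[a, b]%classic f (kernelSE ell)
  (ell * Num.sqrt (2 * pi))^-1 M)//; last 2 first.
- by have := ltry (b - a); rewrite -lab.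
- by move=> x; rewrite /kernelSE subrr expr0n/= oppr0 mul0r expR0 mulr1.
pose F := f \_ (`[a, b] `*` `[a, b]).
have mF : measurable_fun setT F.
  by apply/(measurable_restrictT _ _).1 => //; exact: measurableX.
have FM z : `|F z| <= M.
  by rewrite /F patchE; case: ifPn => [/set_mem/fM //|_]; rewrite normr0.
have F0 z : ~ (`[a, b] `*` `[a, b]) z -> F z = 0.
  by move=> nz; rewrite /F patchE memNset.
have FE x y : x \in `[a, b] -> y \in `[a, b] -> F (x, y) = f (x, y).
  by move=> xab yab; rewrite /F patchE mem_set.
have -> : (trace `[a, b] f)%:E = (\int[lebesgue_measure]_x (F (x, x))%:E)%E.
  rewrite /trace Rintegral_mkcond /Rintegral.
  under eq_integral => x _.
    rewrite (_ : _ x = F (x, x)); last first.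
      rewrite /F !patchE; congr (if _ then _ else _).
      by apply/idP/idP => /set_mem => [xab|[xab _]]; exact/mem_set.
    over.
  rewrite fineK//; apply: integrable_fin_num => //.
  have := @bounded_support_integrable _ _ _ (@lebesgue_measure R) `[a, b]%classic
    (fun x => F (x, x)) M.
  apply => //.
  - by have := ltry (b - a); rewrite -lab.
  - by apply: (measurableT_comp mF); exact: measurable_fun_pair.
  - by move=> x nx; apply: F0 => -[].
under eq_integral do under eq_integral do rewrite kernelSE_normal_pdf//.
have ba : 0 < b - a by rewrite subr_gt0.
have eN : 0 < eps * N by rewrite mulr_gt0.
pose eta := eps * N / (4 * (b - a)).
apply: (le_lt_trans (@normal_smoothing_trace_error R F a b ell d M eta
  hab hell0 hd _ mF FM F0 _)).
- by rewrite divr_ge0 ?mulr_ge0// ltW.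
- move=> x y xab yab xy; rewrite !FE//; apply: hfd => //.
  by rewrite distrC.
rewrite lte_fin.
(* From [pi / 2 < 2] follows [2 * pi < 8 <= 3^2]. *)
have sqrt2pi : Num.sqrt (2 * pi) <= 3 :> R.
  rewrite -(@ler_pXn2r _ 2) ?nnegrE ?sqrtr_ge0// sqr_sqrtr ?mulr_ge0 ?pi_ge0//.
  by have := @pihalf_lt2 R; lra.
have etaE : (b - a) * eta = eps * N / 4 by rewrite /eta; field; rewrite gt_eqF.
have Msqrt2pi : M * ell * Num.sqrt (2 * pi) <= M * ell * 3.
  by rewrite ler_wpM2l// mulr_ge0// ltW.
(* With [t = eps * N], the three terms are at most [t / 4], [t / 4] and [15 t / 52], in total
   [41 t / 52 < t]. *)
by rewrite (mulrDr (b - a)) etaE; set e := expR _ in dN *; lra.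
Qed.
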